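(* The number of pairs $(x,y)$ such that $x,y\in\mathfrak{o}'$, $\bar xy\in\mathfrak{o}'$, and $N(x)=N(y)=1$, is $7560$.
   Context: $\mathfrak{C}_{\mathbb{Q}}=\bigoplus_{i=0}^7\mathbb{Q}e_i$ is the algebra of octonions (Cayley numbers): $e_0$ is the unit, and $e_i^2=-e_0$, $e_i(e_{i+1}e_{i+3})=(e_ie_{i+1})e_{i+3}=-e_0$ for $1\le i\le 7$ (indices modulo $7$ in $\{1,\dots,7\}$), the span of $e_0,e_i,e_{i+1},e_{i+3}$ being a quaternion algebra. For $x=\sum_{i=0}^7x_ie_i$ put $\bar x=2x_0e_0-x$ and $N(x)=\sum_{i=0}^7x_i^2$; $x$ is called imaginary if $x_0=0$. The lattice $\mathfrak{o}\subset\mathfrak{C}_{\mathbb{Q}}$ of integral octonions is the $\mathbb{Z}$-span of $\alpha_0=e_0$, $\alpha_1=e_1$, $\alpha_2=e_2$, $\alpha_3=-e_4$, $\alpha_4=\frac12(e_1+e_2+e_3+e_4)$, $\alpha_5=\frac12(-e_0-e_1-e_4+e_5)$, $\alpha_6=\frac12(-e_0+e_1-e_2+e_6)$, $\alpha_7=\frac12(-e_0+e_2+e_4+e_7)$. $\mathfrak{o}'$ is the set of all imaginary elements of $\mathfrak{o}$. *)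

(* Defs.v *)
From mathcomp Require Import all_boot all_order all_algebra.
From mathcomp Require Import boolp classical_sets functions cardinality.

Set Implicit Arguments.
Unset Strict Implicit.
Unset Printing Implicit Defensive.

Import Order.TTheory GRing.Theory Num.Theory.

Local Open Scope ring_scope.
Local Open Scope classical_set_scope.

(* Coordinates are x 0 i, with i : 'I_8. *)
Notation octonion := 'rV[rat]_8.

(* Positive indices are read modulo 7 in {1, ..., 7}: e 8 = e 1, and so on. *)
Definition oct_index (k : nat) : 'I_8 :=
  inord (if k is k'.+1 then (k' %% 7).+1 else 0%N).

Definition e (k : nat) : octonion := delta_mx 0 (oct_index k).

(* For i, j in {1, ..., 7}, the difference j - i mod 7 tells where i and j sit
   on the line {k, k+1, k+3} through them, on which
   e_k e_(k+1) = e_(k+3), e_(k+1) e_(k+3) = e_k, e_(k+3) e_k = e_(k+1):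
   this gives the cases 1, 2 (with k = i - 1) and 4 (with k = i - 3);
   the cases 6, 5, 3 are the products in the opposite order. *)
Definition basis_mul (i j : nat) : octonion :=
  if i == 0%N then e j else if j == 0%N then e i else
  match ((j + 7 - i) %% 7)%N with
  | 0 => - e 0
  | 1 => e (i + 3)
  | 2 => e (i + 6)
  | 4 => e (i + 5)
  | 6 => - e (i + 2)
  | 5 => - e (i + 4)
  | _ => - e (i + 1)
  end.

Definition oct_mul (x y : octonion) : octonion :=
  \sum_(i < 8) \sum_(j < 8) (x 0 i * y 0 j) *: basis_mul i j.

Definition oct_conj (x : octonion) : octonion := (2 * x 0 0) *: e 0 - x.

Definition oct_norm (x : octonion) : rat := \sum_(i < 8) x 0 i ^+ 2.

Definition imaginary (x : octonion) : Prop := x 0 0 = 0.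

Definition alpha : 8.-tuple octonion :=
  [tuple e 0;
         e 1;
         e 2;
         - e 4;
         2^-1 *: (e 1 + e 2 + e 3 + e 4);
         2^-1 *: (- e 0 - e 1 - e 4 + e 5);
         2^-1 *: (- e 0 + e 1 - e 2 + e 6);
         2^-1 *: (- e 0 + e 2 + e 4 + e 7)].

Definition integral_octonions : set octonion := [set x | inIntSpan alpha x].

Definition imaginary_integral_octonions : set octonion :=
  [set x | integral_octonions x /\ imaginary x].

(* The defining relations of the octonions hold for oct_mul; together with
   bilinearity (oct_mul_delta and the definition), they determine it. *)

Lemma oct_mul_delta (a b : 'I_8) :
  oct_mul (delta_mx 0 a) (delta_mx 0 b) = basis_mul a b.
Proof.
rewrite /oct_mul (bigD1 a) //= [X in _ + X]big1 ?addr0; last first.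
  move=> i ia; apply: big1 => j _.
  by rewrite mxE (negPf ia) andbF mul0r scale0r.
rewrite (bigD1 b) //= [X in _ + X]big1 ?addr0; last first.
  by move=> j jb; rewrite !mxE (negPf jb) andbF mulr0 scale0r.
by rewrite !mxE !eqxx mulr1 scale1r.
Qed.

Lemma oct_index_small k : (k < 8)%N -> oct_index k = k :> nat.
Proof.
move=> lt_k8; rewrite /oct_index; case: k lt_k8 => [|k] lt_k8.
  by rewrite inordK.
by rewrite modn_small ?inordK.
Qed.

Lemma e_delta (i : 'I_8) : e i = delta_mx 0 i.
Proof. by congr delta_mx; apply/val_inj; rewrite /= oct_index_small. Qed.

Lemma oct_mul_e i j : (i < 8)%N -> (j < 8)%N ->
  oct_mul (e i) (e j) = basis_mul i j.
Proof. by move=> i8 j8; rewrite oct_mul_delta !oct_index_small. Qed.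

Lemma oct_mul1x (x : octonion) : oct_mul (e 0) x = x.
Proof.
have -> : e 0 = delta_mx 0 0 := e_delta ord0.
rewrite /oct_mul (bigD1 0) //= [X in _ + X]big1 ?addr0; last first.
  move=> i i0; apply: big1 => j _.
  by rewrite mxE (negPf i0) andbF mul0r scale0r.
rewrite [RHS]row_sum_delta; apply: eq_bigr => j _.
by rewrite mxE !eqxx mul1r /basis_mul eqxx e_delta.
Qed.

Lemma oct_mulx1 (x : octonion) : oct_mul x (e 0) = x.
Proof.
have -> : e 0 = delta_mx 0 0 := e_delta ord0.
rewrite /oct_mul [RHS]row_sum_delta; apply: eq_bigr => i _.
rewrite (bigD1 0) //= [X in _ + X]big1 ?addr0; last first.
  by move=> j j0; rewrite mxE (negPf j0) andbF mulr0 scale0r.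
rewrite mxE !eqxx mulr1 /basis_mul; case: eqP => [i0|_]; rewrite -?e_delta //.
by rewrite i0.
Qed.

Lemma oct_mul_e_cyclic (i : 'I_7) :
  let a := e i.+1 in let b := e i.+2 in let c := e i.+4 in
  [/\ oct_mul a a = - e 0,
      [/\ oct_mul a b = c, oct_mul b c = a & oct_mul c a = b] &
      [/\ oct_mul b a = - c, oct_mul c b = - a & oct_mul a c = - b]].
Proof.
have e_mod k : e k.+1 = e (k %% 7).+1 by rewrite /e /oct_index modn_mod.
have mulE j k : oct_mul (e j.+1) (e k.+1) = basis_mul (j %% 7).+1 (k %% 7).+1.
  by rewrite e_mod [e k.+1]e_mod oct_mul_e // ltnS ltn_mod.
case: i => [[|[|[|[|[|[|[|m]]]]]]] lt_m] //=;
  by split; [|split|split]; rewrite mulE.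
Qed.

Lemma oct_mul_relations (i : nat) : (1 <= i <= 7)%N ->
  [/\ oct_mul (e i) (e i) = - e 0,
      oct_mul (e i) (oct_mul (e (i + 1)) (e (i + 3))) = - e 0 &
      oct_mul (oct_mul (e i) (e (i + 1))) (e (i + 3)) = - e 0].
Proof.
case: i => // i; rewrite ltnS => /= lti7; rewrite addn1 addn3.
have [aa [ab bc _] _] := oct_mul_e_cyclic (Ordinal lti7).
rewrite /= in aa ab bc; rewrite bc ab; split=> //.
have lt7 : ((i + 3) %% 7 < 7)%N by rewrite ltn_mod.
have [cc _ _] := oct_mul_e_cyclic (Ordinal lt7).
rewrite /= in cc; have {1 2}-> // : e i.+4 = e ((i + 3) %% 7).+1.
by rewrite /e /oct_index modn_mod addn3.
Qed.

(* Main.v *)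
Require Import Defs.
From mathcomp Require Import all_boot all_order all_algebra.
From mathcomp Require Import boolp classical_sets functions cardinality.
From mathcomp Require Import ring lra zify.

(** For imaginary [x] one has [oct_conj x = - x], and the real part of
    [oct_conj x * y] is the Euclidean inner product of [x] and [y].  The lattice
    of integral octonions is closed under conjugation and multiplication, so
    among the integral [x], [y] the condition on [oct_conj x * y] only says that
    [x] and [y] are orthogonal.  The imaginary integral octonions of norm 1 are
    the 126 roots of a root system of type E7, and the roots orthogonal to a
    given one form a system of type D6, with 60 roots.  Hence there are
    126 * 60 = 7560 pairs.

    The counting is done by evaluation, on integer vectors.  Twice an integral
    octonion has integer coordinates, and an integer vector arises in this way
    exactly when its reduction modulo 2 lies in the extended Hamming code
    ([integral_octonionP]).  The vectors of norm 4 in this lattice with zero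
    real coordinate are listed recursively, coordinate by coordinate
    ([mem_vectors_of_norm], [imaginary_unitP]).  The closure under
    multiplication ([integral_mul]) reduces by bilinearity to the 64 products of
    the generators, which are also evaluated on integer vectors. *)

Import Order.TTheory GRing.Theory Num.Theory.

Local Open Scope ring_scope.
Local Open Scope classical_set_scope.
Local Open Scope card_scope.

(** * Integral octonions as half integer vectors *)

Definition half_vec (h : seq int) : octonion := \row_(i < 8) ((h`_i)%:~R / 2).

(** These four conditions are the parity checks of an extended Hamming [8,4]
    code.  They are found by solving for the coefficients of the generators
    [alpha]: signs are irrelevant modulo 2, and are chosen so that the four
    expressions are twice the coefficients of [alpha_0], ..., [alpha_3]. *)
Definition parity_code (h : seq int) : bool :=
  [&& (2 %| h`_0 + h`_5 + h`_6 + h`_7)%Z, (2 %| h`_1 - h`_3 + h`_5 - h`_6)%Z,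
      (2 %| h`_2 - h`_3 + h`_6 - h`_7)%Z & (2 %| h`_3 - h`_5 + h`_7 - h`_4)%Z].

(** Twice the coordinates of the combination of the generators [alpha] with
    coefficients [a]. *)
Definition span_coords (a : nat -> int) : seq int :=
  [:: 2 * a 0%N - a 5%N - a 6%N - a 7%N;
      2 * a 1%N + a 4%N - a 5%N + a 6%N;
      2 * a 2%N + a 4%N - a 6%N + a 7%N;
      a 4%N;
      - (2 * a 3%N) + a 4%N - a 5%N + a 7%N;
      a 5%N; a 6%N; a 7%N].

Lemma half_vec_inj h g : size h = 8%N -> size g = 8%N ->
  half_vec h = half_vec g -> h = g.
Proof.
move=> sh sg eq_hg; apply: (@eq_from_nth _ 0); first by rewrite sh sg.
move=> i; rewrite sh => lt_i8.
move/rowP/(_ (Ordinal lt_i8)): eq_hg; rewrite !mxE /= => /mulIf.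
by move=> /(_ isT)/intr_inj.
Qed.

Lemma span_coordsE (a : nat -> int) :
  \sum_(i < 8) alpha`_i *~ a i = half_vec (span_coords a).
Proof.
have oct_idxE (j : 'I_8) k : (k < 8)%N -> (j == oct_index k) = (j == k :> nat).
  by move=> k8; rewrite -val_eqE /= oct_index_small.
apply/rowP => j; rewrite !big_ord_recl big_ord0 /=.
rewrite /e -!scaler_int !mxE !eqxx /= !oct_idxE //.
case: j => [[|[|[|[|[|[|[|[|m]]]]]]]] lt_m] //=;
  rewrite /bump /= ?rmorphD ?rmorphN ?rmorphM /=; lra.
Qed.

(** The system [span_coords a = h] is triangular: the coordinates 3, 5, 6, 7
    of [h] are coefficients, and the four others then yield the remaining
    coefficients after division by 2. *)
Lemma integral_octonionP x :
  integral_octonions x <->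
  exists h, [/\ size h = 8%N, parity_code h & x = half_vec h].
Proof.
split=> [[a ->]|[h [sh /and4P[]]]]; last first.
  move=> /dvdzP[a0 E0] /dvdzP[a1 E1] /dvdzP[a2 E2] /dvdzP[a3 E3] ->.
  pose a := [:: a0; a1; a2; a3; h`_3; h`_5; h`_6; h`_7].
  exists [ffun i : 'I_8 => a`_i].
  under eq_bigr do rewrite ffunE.
  rewrite (span_coordsE (fun i => a`_i)); congr half_vec.
  apply: (@eq_from_nth _ 0) => //; rewrite sh.
  by move=> [|[|[|[|[|[|[|[|i]]]]]]]] //= _; lra.
exists (span_coords (fun k => a (inord k))); split=> //.
  by rewrite /parity_code /=; apply/and4P; split; apply/dvdzP;
    [exists (a (inord 0)) | exists (a (inord 1)) | exists (a (inord 2))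
    | exists (a (inord 3))]; ring.
by rewrite -span_coordsE; apply: eq_bigr => i _; rewrite inord_val.
Qed.

(** * The integral octonions form a ring with involution *)

Lemma integral0 : integral_octonions 0.
Proof.
by exists [ffun=> 0]; rewrite big1 // => i _; rewrite ffunE mulr0z.
Qed.

Lemma integralD x y :
  integral_octonions x -> integral_octonions y -> integral_octonions (x + y).
Proof.
move=> [a ->] [b ->]; exists [ffun i => a i + b i].
by rewrite -big_split; apply: eq_bigr => i _; rewrite ffunE mulrzDr.
Qed.

Lemma integralMz x n : integral_octonions x -> integral_octonions (x *~ n).
Proof.
move=> [a ->]; exists [ffun i => a i * n].
by rewrite mulrz_suml; apply: eq_bigr => i _; rewrite ffunE mulrzA.
Qed.

Lemma integral_lincomb (F : 'I_8 -> octonion) (a : 'I_8 -> int) :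
  (forall i, integral_octonions (F i)) ->
  integral_octonions (\sum_i F i *~ a i).
Proof.
move=> oF; elim/big_ind: _ => [|x y|i _]; [exact: integral0|exact: integralD|].
exact: integralMz.
Qed.

Lemma oct_mulDl (x x' y : octonion) :
  oct_mul (x + x') y = oct_mul x y + oct_mul x' y.
Proof.
rewrite /oct_mul -big_split; apply: eq_bigr => i _.
by rewrite -big_split; apply: eq_bigr => j _; rewrite mxE mulrDl scalerDl.
Qed.

Lemma oct_mulDr (x y y' : octonion) :
  oct_mul x (y + y') = oct_mul x y + oct_mul x y'.
Proof.
rewrite /oct_mul -big_split; apply: eq_bigr => i _.
by rewrite -big_split; apply: eq_bigr => j _; rewrite mxE mulrDr scalerDl.
Qed.

Lemma oct_mulZl c (x y : octonion) : oct_mul (c *: x) y = c *: oct_mul x y.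
Proof.
rewrite /oct_mul scaler_sumr; apply: eq_bigr => i _.
by rewrite scaler_sumr; apply: eq_bigr => j _; rewrite mxE scalerA mulrA.
Qed.

Lemma oct_mulZr c (x y : octonion) : oct_mul x (c *: y) = c *: oct_mul x y.
Proof.
rewrite /oct_mul scaler_sumr; apply: eq_bigr => i _.
by rewrite scaler_sumr; apply: eq_bigr => j _; rewrite mxE scalerA mulrCA.
Qed.

Lemma oct_mul_lincomb (F G : 'I_8 -> octonion) (a b : 'I_8 -> int) :
  oct_mul (\sum_i F i *~ a i) (\sum_j G j *~ b j) =
  \sum_i (\sum_j oct_mul (F i) (G j) *~ b j) *~ a i.
Proof.
rewrite (big_morph (oct_mul^~ _) (id1 := 0) (op1 := +%R)); last 2 first.
- by move=> x y; exact: oct_mulDl.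
- by have := oct_mulZl 0 0 (\sum_j G j *~ b j); rewrite !scale0r.
apply: eq_bigr => i _; rewrite -scaler_int oct_mulZl scaler_int; congr (_ *~ _).
rewrite (big_morph (oct_mul _) (id1 := 0) (op1 := +%R)); last 2 first.
- by move=> x y; exact: oct_mulDr.
- by have := oct_mulZr 0 (F i) 0; rewrite !scale0r.
by apply: eq_bigr => j _; rewrite -scaler_int oct_mulZr scaler_int.
Qed.

(** A sum that reduces by evaluation, which the locked [\sum] does not. *)
Definition sum8 (F : nat -> int) : int := foldr +%R 0 [seq F i | i <- iota 0 8].

Lemma sum8E F : sum8 F = \sum_(i < 8) F i.
Proof. by rewrite /sum8 foldrE big_map -/(index_iota 0 8) big_mkord. Qed.

(** The table of [basis_mul], with the sign (negative for [true]) and the index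
    kept apart so that both can be evaluated; [idx] brings a positive index
    back to 1, ..., 7. *)
Definition signed_basis_mul (i j : nat) : bool * nat :=
  if i == 0%N then (false, j) else if j == 0%N then (false, i) else
  let idx k := (k.-1 %% 7).+1 in
  match ((j + 7 - i) %% 7)%N with
  | 0 => (true, 0%N)
  | 1 => (false, idx (i + 3)%N)
  | 2 => (false, idx (i + 6)%N)
  | 4 => (false, idx (i + 5)%N)
  | 6 => (true, idx (i + 2)%N)
  | 5 => (true, idx (i + 4)%N)
  | _ => (true, idx (i + 1)%N)
  end.

Lemma basis_mulE (i j : 'I_8) :
  let: (s, k) := signed_basis_mul i j in basis_mul i j = (-1) ^+ s *: e k.
Proof.
case: i j => [[|[|[|[|[|[|[|[|i]]]]]]]] lti] //
  [[|[|[|[|[|[|[|[|j]]]]]]]] ltj] //=;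
  rewrite /basis_mul /= ?scale1r ?scaleN1r //; congr (- _).
Qed.

Definition struct_const (i j k : nat) : int :=
  let: (s, l) := signed_basis_mul i j in
  if l == k then (if s then -1 else 1) else 0.

Lemma basis_mul_coord (i j k : 'I_8) :
  basis_mul i j 0 k = (struct_const i j k)%:~R.
Proof.
have := basis_mulE i j; rewrite /struct_const.
have : ((signed_basis_mul i j).2 < 8)%N.
  rewrite /signed_basis_mul; case: eqP => //= _; case: eqP => //= _.
  by case: (_ %% 7)%N => [|[|[|[|[|[|[|m]]]]]]] //=; rewrite ltnS ltn_mod.
case: (signed_basis_mul i j) => s l /= l8 ->.
rewrite mxE /e mxE eqxx /= -val_eqE /= oct_index_small // eq_sym.
by case: (l == k); case: s; rewrite ?mulr1 ?mulr0.
Qed.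

Definition int_mul (h g : seq int) : seq int :=
  [seq sum8 (fun i => sum8 (fun j => h`_i * g`_j * struct_const i j k))
     | k <- iota 0 8].

(** The factor 1/2 remains because two halves are multiplied while
    [half_vec] accounts for only one. *)
Lemma oct_mul_half_vec (h g : seq int) :
  oct_mul (half_vec h) (half_vec g) = 2^-1 *: half_vec (int_mul h g).
Proof.
apply/rowP => k; rewrite !mxE (nth_map 0%N) ?size_iota ?nth_iota // add0n.
rewrite sum8E summxE rmorph_sum /= mulr_suml mulr_sumr; apply: eq_bigr => i _.
rewrite sum8E summxE rmorph_sum /= mulr_suml mulr_sumr; apply: eq_bigr => j _.
rewrite !mxE basis_mul_coord !rmorphM /=; ring.
Qed.

Definition alpha_coords (i : nat) : seq int :=
  span_coords (fun j => (j == i)%:Z).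

Lemma alpha_half_vec (i : 'I_8) : alpha`_i = half_vec (alpha_coords i).
Proof.
rewrite -span_coordsE (bigD1 i) //= eqxx mulr1z big1 ?addr0 // => j.
by rewrite -val_eqE => /negPf /= ->.
Qed.

Definition halfz (h : seq int) : seq int := [seq (c %/ 2)%Z | c <- h].

(** Each product of two doubled generators is four times an integral octonion:
    it must be even before the parity checks apply to its half. *)
Lemma alpha_products :
  all (fun i => all (fun j =>
    let h := int_mul (alpha_coords i) (alpha_coords j) in
    all (fun c => 2 %| c)%Z h && parity_code (halfz h)) (iota 0 8)) (iota 0 8).
Proof. by vm_compute. Qed.

Lemma integral_mul_alpha (i j : 'I_8) :
  integral_octonions (oct_mul alpha`_i alpha`_j).
Proof.
have mem8 (k : 'I_8) : (k : nat) \in iota 0 8 by rewrite mem_iota /= ltn_ord.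
move/allP/(_ _ (mem8 i))/allP/(_ _ (mem8 j))/andP: alpha_products.
rewrite !alpha_half_vec oct_mul_half_vec.
set h := int_mul _ _ => -[/allP h_even code_h].
have sh : size h = 8%N by rewrite size_map size_iota.
apply/integral_octonionP; exists (halfz h).
split=> //.
apply/rowP => k; have /h_even/divzK h_k : h`_k \in h by rewrite mem_nth ?sh.
have half_k : (halfz h)`_k = (h`_k %/ 2)%Z by rewrite (nth_map 0) ?sh.
by rewrite !mxE half_k -{1}h_k rmorphM /=; field.
Qed.

Lemma integral_mul x y :
  integral_octonions x -> integral_octonions y ->
  integral_octonions (oct_mul x y).
Proof.
move=> [a ->] [b ->]; rewrite oct_mul_lincomb.
apply: integral_lincomb => i; apply: integral_lincomb => j.
exact: integral_mul_alpha.
Qed.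

Lemma integral_e0 : integral_octonions (e 0).
Proof.
exists [ffun i => (i == ord0)%:Z].
rewrite (bigD1 ord0) //= ffunE eqxx mulr1z big1 ?addr0 // => i /negPf i0.
by rewrite ffunE i0.
Qed.

(** The coordinate of an integral octonion on [e 0] is half an integer, so that
    [oct_conj x] is an integer multiple of [e 0] minus [x]. *)
Lemma integral_conj x : integral_octonions x -> integral_octonions (oct_conj x).
Proof.
move=> ox; have /integral_octonionP[h [_ _ Dx]] := ox.
have -> : oct_conj x = e 0 *~ h`_0 + x *~ -1.
  by rewrite mulrNz mulr1z /oct_conj -scaler_int Dx mxE; congr (_ *: _ - _);
    field.
by apply: integralD; apply: integralMz => //; exact: integral_e0.
Qed.

(** A product of two basis elements has a real part only if they are equal; the
    square of [e i] is then [- e 0] for positive [i], and this sign cancels with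
    that of the conjugation. *)
Lemma oct_conj_mul_coord0 (x y : octonion) :
  oct_mul (oct_conj x) y 0 0 = \sum_(i < 8) x 0 i * y 0 i.
Proof.
rewrite summxE; apply: eq_bigr => i _.
rewrite summxE (bigD1 i) //= big1 ?addr0 => [|j ji].
  rewrite !mxE basis_mul_coord eqxx /= -val_eqE /= oct_index_small //.
  case: (unliftP ord0 i) => [i' ->|->] /=; last by rewrite mulr1; ring.
  by rewrite /struct_const /signed_basis_mul /= addnC addnK modnn /=; ring.
rewrite mxE basis_mul_coord.
suff -> : struct_const i j ord0 = 0 by rewrite mulr0.
move: ji; rewrite -val_eqE.
by case: i j => [[|[|[|[|[|[|[|[|i]]]]]]]] lti] //
  [[|[|[|[|[|[|[|[|j]]]]]]]] ltj].
Qed.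

(** * The imaginary units: the roots of E7 *)

Definition norm_sq (h : seq int) : nat := sumn [seq `|c|%N ^ 2 | c <- h]%N.

Lemma norm_sq_cons c h : norm_sq (c :: h) = (`|c|%N ^ 2 + norm_sq h)%N.
Proof. by []. Qed.

Lemma oct_norm_half_vec h : size h = 8%N ->
  oct_norm (half_vec h) = (norm_sq h)%:R / 4.
Proof.
move=> sh; rewrite /norm_sq sumnE big_map (big_nth 0) sh big_mkord natr_sum.
rewrite mulr_suml; apply: eq_bigr => i _; rewrite mxE natrX natr_absz.
by rewrite expr_div_n intr_norm real_normK ?num_real.
Qed.

Definition int_range (m : nat) : seq int :=
  [seq Posz k | k <- iota 0 m.+1] ++ [seq - Posz k | k <- iota 1 m].

Lemma mem_int_range c m : (`|c| <= m)%N -> c \in int_range m.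
Proof.
move=> cm; rewrite mem_cat; case: (lerP 0 c) => c0; apply/orP.
  by left; apply/mapP; exists `|c|%N; rewrite ?mem_iota; lia.
by right; apply/mapP; exists `|c|%N; rewrite ?mem_iota; lia.
Qed.

(** The first coordinate consumes its square from the norm [m] left for the
    following ones, so that a branch stops once this norm is exceeded and the
    evaluation of [roots] stays short. *)
Fixpoint vectors_of_norm (n m : nat) : seq (seq int) :=
  if n is n'.+1 then
    [seq c :: h | c <- [seq c <- int_range m | `|c|%N ^ 2 <= m],
                  h <- vectors_of_norm n' (m - `|c|%N ^ 2)]%N
  else if m == 0%N then [:: [::]] else [::].

Lemma mem_vectors_of_norm n m h :
  (h \in vectors_of_norm n m) = (size h == n) && (norm_sq h == m).
Proof.
elim: n m h => [|n IHn] m h.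
  by case: h => [|c h] /=; rewrite eq_sym; case: eqP; rewrite ?inE.
apply/allpairsPdep/andP => [[c [g [+ + ->]]]|[]].
  rewrite mem_filter IHn => /andP[cm _] /andP[/eqP sg /eqP ng].
  by rewrite norm_sq_cons /= sg ng subnKC.
case: h => [//|c h] sh; rewrite norm_sq_cons => /eqP <-.
exists c, h; split; [|by rewrite IHn -eqSS sh addKn eqxx|by []].
rewrite mem_filter leq_addr mem_int_range //; apply: leq_trans (leq_addr _ _).
by case: absz => // k; rewrite expnS leq_pmulr ?expn_gt0.
Qed.

(** The norm is 4 because the coordinates are doubled. *)
Definition roots : seq (seq int) :=
  [seq h <- vectors_of_norm 8 4 | (h`_0 == 0) && parity_code h].

Lemma roots_size8 h : h \in roots -> size h = 8%N.
Proof.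
by rewrite mem_filter mem_vectors_of_norm => /andP[_ /andP[/eqP]].
Qed.

Lemma imaginary_unitP x :
  imaginary_integral_octonions x /\ oct_norm x = 1 <->
  exists2 h, h \in roots & x = half_vec h.
Proof.
split=> [[[/integral_octonionP[h [sh code_h ->]]]]|[h h_root ->]].
  rewrite /imaginary mxE oct_norm_half_vec // => h0 hn; exists h => //.
  rewrite mem_filter mem_vectors_of_norm sh code_h andbT /=; apply/andP; split.
    by rewrite -(@intr_eq0 rat); apply/eqP; lra.
  by rewrite -(eqr_nat rat); apply/eqP; lra.
have sh := roots_size8 h h_root; move: h_root.
rewrite mem_filter mem_vectors_of_norm.
move=> /andP[/andP[/eqP h0 code_h] /andP[_ /eqP hn]].
split; last by rewrite oct_norm_half_vec // hn divff.
split; last by rewrite /imaginary mxE h0 mul0r.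
by apply/integral_octonionP; exists h.
Qed.

(** * Orthogonal pairs of roots *)

Definition dot (h g : seq int) : int := sum8 (fun i => h`_i * g`_i).

Lemma conj_mul_half_vec_coord0 h g :
  oct_mul (oct_conj (half_vec h)) (half_vec g) 0 0 = (dot h g)%:~R / 4.
Proof.
rewrite oct_conj_mul_coord0 /dot sum8E rmorph_sum mulr_suml.
by apply: eq_bigr => i _; rewrite !mxE rmorphM /=; field.
Qed.

Definition orthogonal_pairs : seq (seq int * seq int) :=
  [seq (h, g) | h <- roots, g <- [seq g <- roots | dot h g == 0]].

Lemma size_roots : size roots = 126%N.
Proof. by vm_compute. Qed.

Lemma uniq_roots : uniq roots.
Proof. by vm_compute. Qed.

Lemma orthogonal_roots_count :
  all (fun h => count (fun g => dot h g == 0) roots == 60%N) roots.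
Proof. by vm_compute. Qed.

Lemma size_orthogonal_pairs : size orthogonal_pairs = 7560%N.
Proof.
rewrite size_allpairs_dep.
have /eq_in_map -> : {in roots, forall h,
    size [seq g <- roots | dot h g == 0] = 60%N}.
  by move=> h hr; rewrite size_filter; exact/eqP/(allP orthogonal_roots_count).
by rewrite sumnE big_map big_const_seq count_predT size_roots iter_addn_0.
Qed.

Lemma uniq_orthogonal_pairs : uniq orthogonal_pairs.
Proof.
apply: allpairs_uniq_dep => [|h _|]; first exact: uniq_roots.
  exact: filter_uniq uniq_roots.
by move=> [h g] [h' g'] _ _ [-> ->].
Qed.

Lemma mem_orthogonal_pairs h g :
  ((h, g) \in orthogonal_pairs) =
  [&& h \in roots, g \in roots & dot h g == 0].
Proof.
apply/allpairsPdep/and3P => [[h' [g' [hr + [-> ->]]]]|[hr gr hg]].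
  by rewrite mem_filter => /andP[].
exists h, g; split=> //; rewrite (mem_filter (fun g => dot h g == 0)).
by apply/andP.
Qed.

Theorem proposition3p9 :
  [set p : octonion * octonion |
     [/\ imaginary_integral_octonions p.1,
         imaginary_integral_octonions p.2,
         imaginary_integral_octonions (oct_mul (oct_conj p.1) p.2),
         oct_norm p.1 = 1 & oct_norm p.2 = 1]] #= `I_7560.
Proof.
set pairs := mkset _.
pose halves (p : seq int * seq int) := (half_vec p.1, half_vec p.2).
pose enum_pair k := halves (nth ([::], [::]) orthogonal_pairs k).
have halves_inj : {in orthogonal_pairs &, injective halves}.
  move=> [h g] [h' g']; rewrite !mem_orthogonal_pairs.
  move=> /and3P[hr gr _] /and3P[hr' gr' _] [].
  by move=> /half_vec_inj-> => [/half_vec_inj->||]; rewrite ?roots_size8.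
(* The bound stays folded in what follows, since simplification would expand
   the numeral into 7560 successors. *)
have in_range k : `I_7560 k <-> (k < size orthogonal_pairs)%N.
  by rewrite size_orthogonal_pairs.
have enum_inj : {in `I_7560 &, injective enum_pair}.
  move=> k l /set_mem/in_range lt_k /set_mem/in_range lt_l eq_kl.
  apply/eqP; rewrite -(nth_uniq ([::], [::]) lt_k lt_l uniq_orthogonal_pairs).
  apply/eqP; move: eq_kl; apply: halves_inj; exact: mem_nth.
suff -> : pairs = enum_pair @` `I_7560.
  exact: inj_card_eq.
apply/seteqP; split=> [[x y] [/= ox oy [_ xy0] nx ny]|_ [k /in_range lt_k <-]].
  have [h hr Dx] := (imaginary_unitP x).1 (conj ox nx).
  have [g gr Dy] := (imaginary_unitP y).1 (conj oy ny).
  move: xy0; rewrite /imaginary Dx Dy conj_mul_half_vec_coord0 => hg0.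
  have hg : (h, g) \in orthogonal_pairs.
    by rewrite mem_orthogonal_pairs hr gr -(@intr_eq0 rat); apply/eqP; lra.
  exists (index (h, g) orthogonal_pairs).
    by apply/in_range; rewrite index_mem.
  by rewrite /enum_pair nth_index.
move: (mem_nth ([::], [::]) lt_k); rewrite /enum_pair.
case: nth => h g; rewrite mem_orthogonal_pairs => /and3P[hr gr /eqP hg0].
have [ox nx] := (imaginary_unitP _).2 (ex_intro2 _ _ h hr erefl).
have [oy ny] := (imaginary_unitP _).2 (ex_intro2 _ _ g gr erefl).
split=> //; split.
  by apply: integral_mul; [apply: integral_conj; exact: ox.1|exact: oy.1].
by rewrite /imaginary conj_mul_half_vec_coord0 hg0 mul0r.
Qed.
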